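(* Let $G=(V,E)$ and $H=(W,F)$ be finite simple graphs with $V\cap W=\emptyset$, $|V|=s$, $|W|=t$. Then \[ Q(G\vee H;x,y)=Q(G;x,y)+Q(H;x,y)+\left[(1+x)^s-1\right]\left[(1+x)^t-1\right]y-1. \]
   Context: For a finite simple graph $G=(V,E)$, $Q(G;x,y)=\sum_{X\subseteq V}x^{|X|}y^{k(G[X])}$, where $G[X]$ is the induced subgraph and $k$ the number of connected components (the null graph has $k=0$). The join $G\vee H$ is obtained from the disjoint union of $G$ and $H$ by adding an edge from every vertex of $G$ to every vertex of $H$. *)

(* Defs.v *)
From mathcomp Require Import all_boot all_order all_algebra.

Set Implicit Arguments.
Unset Strict Implicit.
Unset Printing Implicit Defensive.

Import GRing.Theory.
Local Open Scope ring_scope.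

Record sgraph (T : finType) := SGraph {
  adj :> rel T;
  adj_sym : symmetric adj;
  adj_irrefl : irreflexive adj }.

Section Induced.
Variables (T : finType) (G : sgraph T) (X : {set T}).

Definition induced_rel : rel {v : T | v \in X} :=
  [rel u v | G (val u) (val v)].

Lemma induced_sym : symmetric induced_rel.
Proof. by move=> u v; apply: adj_sym. Qed.

Lemma induced_irrefl : irreflexive induced_rel.
Proof. by move=> u; apply: adj_irrefl. Qed.

Definition induced : sgraph {v : T | v \in X} :=
  SGraph induced_sym induced_irrefl.

End Induced.

Definition ncomponents (T : finType) (G : sgraph T) : nat := n_comp G T.

(* Vertices of G and H are made disjoint by taking the sum type T + U. *)
Section Join.
Variables (T U : finType) (G : sgraph T) (H : sgraph U).

Definition join_rel : rel (T + U) := fun a b =>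
  match a, b with
  | inl u, inl v => G u v
  | inr u, inr v => H u v
  | _, _ => true
  end.

Lemma join_sym : symmetric join_rel.
Proof. by move=> [u|u] [v|v] //=; apply: adj_sym. Qed.

Lemma join_irrefl : irreflexive join_rel.
Proof. by move=> [u|u] /=; apply: adj_irrefl. Qed.

Definition join : sgraph (T + U)%type := SGraph join_sym join_irrefl.

End Join.

(* Z[x, y] is represented as {poly {poly int}}. *)
Definition vx : {poly {poly int}} := 'X.
Definition vy : {poly {poly int}} := 'X%:P.

Definition Qpoly (T : finType) (G : sgraph T) : {poly {poly int}} :=
  \sum_(X : {set T}) vx ^+ #|X| * vy ^+ ncomponents (induced G X).

(* Main.v *)
(* A vertex set of the join splits as a pair (A, B). If one part is empty, the
   induced subgraph lies inside G or H; if both are nonempty, every vertex is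
   within distance two of any vertex of A, so there is a single component and
   the corresponding terms factor as a product of two binomial sums times y. *)
Require Import Defs.
From mathcomp Require Import all_boot all_order all_algebra.

Set Implicit Arguments.
Unset Strict Implicit.
Unset Printing Implicit Defensive.

Import GRing.Theory.
Local Open Scope ring_scope.

Lemma connect_sym_sgraph (T : finType) (G : sgraph T) : connect_sym G.
Proof. exact/sym_connect_sym/adj_sym. Qed.

(** Restricted to [A], the map [h] is a bijection onto [h @: A] that preserves and reflects
    adjacency, so connectivity classes correspond one to one. *)
Lemma ncomponents_embedding (T U : finType) (G : sgraph T) (K : sgraph U)
    (h : T -> U) (A : {set T}) :
    injective h -> (forall u v, K (h u) (h v) = G u v) ->
  ncomponents (induced K (h @: A)) = ncomponents (induced G A).
Proof.
move=> h_inj hE.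
pose f (u : {v | v \in A}) : {w | w \in h @: A} :=
  exist _ (h (val u)) (imset_f h (valP u)).
have f_inj : injective f by move=> u v /(congr1 val) /= /h_inj /val_inj.
rewrite /ncomponents (@adjunction_n_comp _ _ f _ (induced G A)) //.
- exact: connect_sym_sgraph.
- exact: connect_sym_sgraph.
(* Surjectivity of [f] and agreement of the edges are what remains. *)
apply: strict_adjunction => //.
- exact: connect_sym_sgraph.
- apply/subsetP=> -[w wA] _; have /imsetP[u uA def_w] := wA.
  by apply/codomP; exists (exist _ u uA); apply: val_inj.
- by move=> u v _; apply: hE.
Qed.

Lemma ncomponents_set0 (T : finType) (G : sgraph T) :
  ncomponents (induced G set0) = 0%N.
Proof.
by apply: eq_card0 => -[v v0]; have := v0; rewrite inE.
Qed.

Lemma ncomponents_connected (T : finType) (G : sgraph T) (x : T) :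
  (forall y, connect G x y) -> ncomponents G = 1%N.
Proof.
(* The class of [x] counts as one component, and by [Gx] it is the whole vertex type. *)
move=> Gx; rewrite -(n_comp_connect (connect_sym_sgraph G) x).
by apply: eq_n_comp_r => y; rewrite [RHS]Gx.
Qed.

Section JoinSubsets.
Variables (V W : finType) (G : sgraph V) (H : sgraph W).

Definition sum_set (A : {set V}) (B : {set W}) : {set V + W} :=
  inl @: A :|: inr @: B.

Lemma mem_sum_setl A B v : (inl v \in sum_set A B) = (v \in A).
Proof.
rewrite !inE mem_imset; last by move=> ? ? [].
by case: imsetP => [[]|]; rewrite ?orbF.
Qed.

Lemma mem_sum_setr A B w : (inr w \in sum_set A B) = (w \in B).
Proof.
rewrite !inE (mem_imset B); last by move=> ? ? [].
by case: imsetP => [[]|].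
Qed.

Lemma card_sum_set A B : #|sum_set A B| = (#|A| + #|B|)%N.
Proof.
rewrite cardsU !card_imset; try by move=> ? ? [].
suff -> : inl @: A :&: inr @: B = set0 by rewrite cards0 subn0.
apply/setP=> -[v|w]; rewrite !inE; apply/negP=> /andP[].
  by move=> _ /imsetP[].
by move=> /imsetP[].
Qed.

Lemma big_sum_set (F : {set V + W} -> {poly {poly int}}) :
  \sum_X F X = \sum_A \sum_B F (sum_set A B).
Proof.
rewrite pair_bigA (reindex (fun p => sum_set p.1 p.2)) //=.
(* The inverse bijection recovers each part as a preimage under its injection. *)
exists (fun X : {set V + W} => (inl @^-1: X, inr @^-1: X)).
  move=> [A B] _ /=; congr (_, _); apply/setP=> u.
    by rewrite inE mem_sum_setl.
  by rewrite inE mem_sum_setr.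
move=> X _; apply/setP=> -[v|w] /=.
  by rewrite mem_sum_setl inE.
by rewrite mem_sum_setr inE.
Qed.

Lemma ncomponents_join_setl A :
  ncomponents (induced (join G H) (sum_set A set0)) = ncomponents (induced G A).
Proof.
rewrite /sum_set imset0 setU0.
by apply: ncomponents_embedding => // ? ? [].
Qed.

Lemma ncomponents_join_setr B :
  ncomponents (induced (join G H) (sum_set set0 B)) = ncomponents (induced H B).
Proof.
rewrite /sum_set imset0 set0U.
by apply: ncomponents_embedding => // ? ? [].
Qed.

Lemma ncomponents_join A B : A != set0 -> B != set0 ->
  ncomponents (induced (join G H) (sum_set A B)) = 1%N.
Proof.
move=> /set0Pn[a aA] /set0Pn[b bB].
have a_in : inl a \in sum_set A B by rewrite mem_sum_setl.
have b_in : inr b \in sum_set A B by rewrite mem_sum_setr.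
pose S := {u : V + W | u \in sum_set A B}.
apply: (@ncomponents_connected _ _ (exist _ (inl a) a_in : S)) => -[[v|w] x_in].
  (* [inl a] and [inl v] need not be adjacent, but [inr b] is a neighbour of both. *)
  apply: (@connect_trans _ _ (exist _ (inr b) b_in : S)); exact: connect1.
exact: connect1.
Qed.

End JoinSubsets.

Lemma sum_expr_card (R : comPzRingType) (T : finType) (x : R) :
  \sum_(A : {set T}) x ^+ #|A| = (1 + x) ^+ #|T|.
Proof.
(* Expand one factor [x + 1] per element of [T]; [A] collects the elements where [x] is chosen. *)
rewrite addrC -prodr_const bigA_distr; apply: eq_bigr => A _.
by rewrite -big_mkcond /= prodr_const.
Qed.

Lemma sum_expr_card_neq0 (R : comPzRingType) (T : finType) (x : R) :
  \sum_(A : {set T} | A != set0) x ^+ #|A| = (1 + x) ^+ #|T| - 1.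
Proof.
by rewrite -sum_expr_card [in RHS](bigD1 set0) //= cards0 expr0 addrAC subrr add0r.
Qed.

(** The null graph has no component, so the empty set contributes exactly [1]. *)
Lemma Qpoly_neq0 (T : finType) (G : sgraph T) :
  Qpoly G = 1 + \sum_(A : {set T} | A != set0)
                  vx ^+ #|A| * vy ^+ ncomponents (induced G A).
Proof.
by rewrite /Qpoly (bigD1 set0) //= cards0 ncomponents_set0 !expr0 mulr1.
Qed.

Theorem theorem5p7 (V W : finType) (G : sgraph V) (H : sgraph W) (s t : nat)
    (hs : #|V| = s) (ht : #|W| = t) :
  Qpoly (join G H) =
    Qpoly G + Qpoly H
    + ((1 + vx) ^+ s - 1) * ((1 + vx) ^+ t - 1) * vy - 1.
Proof.
rewrite -hs -ht -!sum_expr_card_neq0 {1}/Qpoly big_sum_set (bigD1 set0) //=.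
(* The terms with empty [A], including the one where both parts are empty, make up [Qpoly H]. *)
have -> : \sum_B vx ^+ #|sum_set (set0 : {set V}) B| *
    vy ^+ ncomponents (induced (join G H) (sum_set set0 B)) = Qpoly H.
  apply: eq_bigr => B _.
  by rewrite card_sum_set cards0 add0n ncomponents_join_setr.
rewrite [Qpoly G]Qpoly_neq0 big_distrl big_distrl /=.
(* For nonempty [A], the empty [B] gives a term of [Qpoly G]; the other [B] each give a single
   component, hence one factor [vy]. *)
under eq_bigr => A A0.
  rewrite (bigD1 set0) //= card_sum_set cards0 addn0 ncomponents_join_setl.
  under eq_bigr => B B0 do
    rewrite card_sum_set exprD ncomponents_join // expr1 -mulrA.
  rewrite -big_distrr -big_distrl /= mulrA.
  over.
(* [Qpoly G + Qpoly H] counts the empty set twice, the join only once: the final [- 1] cancels the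
   [1] split off from [Qpoly G]. *)
rewrite big_split /= [1 + _]addrC -!addrA; set a := \sum_(A | _) _.
by rewrite addrCA; congr (_ + _); rewrite [RHS]addrCA; congr (_ + _);
  rewrite addrCA subrr addr0.
Qed.
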